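(* For an irreducible fraction $\frac{r}{s}$ (with $s>0$), the polynomial $\mathcal{S}^\flat_{\frac{r}{s}}(q)$ is palindromic if and only if $r^2\equiv -1\pmod{s}$.
   Context: Irreducible fractions $\frac rs\in\mathbb{Q}$ are written with $s>0$. Each $\frac rs\in\mathbb Q$ has an even-length regular continued fraction $\frac rs=[a_1,\ldots,a_{2m}]=a_1+\cfrac{1}{a_2+\cfrac{1}{\ddots+\cfrac1{a_{2m}}}}$, unique under the conventions: if $\frac rs>0$, then $a_1\ge 0$ and $a_i\ge 1$ for $i\ge2$; if $\frac rs<0$, then $a_1\le 0$ and $a_i\le -1$ for $i\ge 2$; and $\frac01=[-1,1]$. Let $q$ be a formal parameter, $R_q=\begin{pmatrix} q&1\\0&1\end{pmatrix}$, $L_q=\begin{pmatrix}1&0\\1&q^{-1}\end{pmatrix}$, and $M_q(a_1,\ldots,a_{2m})=R_q^{a_1}L_q^{a_2}\cdots R_q^{a_{2m-1}}L_q^{a_{2m}}\in \mathrm{GL}(2,\mathbb Z[q^{\pm1}])$. Matrices act by fractional linear transformations. The left $q$-deformed rational number of $\frac rs=[a_1,\ldots,a_{2m}]$ is $\left[\frac rs\right]^\flat_q=M_q(a_1,\ldots,a_{2m})\left(\frac1{1-q}\right)$. It is written as $\left[\frac rs\right]^\flat_q=\frac{\mathcal R^\flat_{r/s}(q)}{\mathcal S^\flat_{r/s}(q)}$ with $\mathcal R^\flat_{r/s}(q)\in\mathbb Z[q^{\pm1}]$ and $\mathcal S^\flat_{r/s}(q)\in\mathbb Z[q]$ obtained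 by multiplying both entries of the vector $M_q(a_1,\ldots,a_{2m})\begin{pmatrix}1\\1-q\end{pmatrix}$ by a common $\pm q^n$ so that $\mathcal S^\flat_{r/s}(0)=1$. One has $\mathcal R^\flat_{r/s}(1)=r$ and $\mathcal S^\flat_{r/s}(1)=s$. For $f(q)\in\mathbb Z[q]$, $f(q)^\vee:=q^{\deg f}f(q^{-1})$ denotes the reciprocal polynomial, and $f$ is palindromic if $f(q)=f(q)^\vee$. *)

(* Defs.v *)
From HB Require Import structures.
From mathcomp Require Import all_boot all_order all_algebra.
From mathcomp Require Import fraction ring lra zify.

Set Implicit Arguments.
Unset Strict Implicit.
Unset Printing Implicit Defensive.

Import Order.TTheory GRing.Theory Num.Theory.
Local Open Scope ring_scope.

(* In a well-formed expansion no proper tail has value 0, so [_^-1] is a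
   genuine inverse except after the last entry, where [0^-1 = 0] yields
   [a_n + 0 = a_n]. *)
Definition cf_value (a : seq int) : rat :=
  foldr (fun (c : int) (x : rat) => c%:~R + x^-1) 0 a.

(* The sign conventions refer to the sign of r because s > 0 throughout. *)
Definition even_cf (r s : int) (a : seq int) : Prop :=
  [/\ (0 < size a)%N,
      ~~ odd (size a),
      cf_value a = r%:~R / s%:~R &
      [/\ 0 < r -> 0 <= head 0 a /\ all (fun c => 1 <= c) (behead a),
          r < 0 -> head 0 a <= 0 /\ all (fun c => c <= -1) (behead a) &
          r = 0 -> a = [:: -1; 1]]].

(* Z[q] and Z[q, q^-1] both live inside the field of fractions of Z[q]. *)
Definition qfield := {fraction {poly int}}.

Notation "p %:F" := (tofrac p) : ring_scope.

Definition q : qfield := ('X : {poly int})%:F.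

Definition is_laurent (f : qfield) : Prop :=
  exists (p : {poly int}) (n : nat), f = q ^- n * p%:F.

Definition mx22 (a b c d : qfield) : 'M[qfield]_2 :=
  \matrix_(i < 2, j < 2)
    if i == 0 then (if j == 0 then a else b) else (if j == 0 then c else d).

Definition vec2 (a b : qfield) : 'cV[qfield]_2 :=
  \col_(i < 2) if i == 0 then a else b.

Definition Rq : 'M[qfield]_2 := mx22 q 1 0 1.
Definition Lq : 'M[qfield]_2 := mx22 1 0 1 q^-1.

(* The powers are integer powers in the ring of 2 x 2 matrices; a trailing
   unpaired entry, which never occurs in an even-length expansion, is
   ignored. *)
Fixpoint Mq (a : seq int) : 'M[qfield]_2 :=
  if a is a1 :: a2 :: a' then Rq ^ a1 *m (Lq ^ a2 *m Mq a') else 1.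

Definition moebius (A : 'M[qfield]_2) (z : qfield) : qfield :=
  (A 0 0 * z + A 0 1) / (A 1 0 * z + A 1 1).

Definition left_qrat (a : seq int) : qfield := moebius (Mq a) (1 / (1 - q)).

(* [left_qrat_pair r s N S]: the left q-deformed rational of r/s, written as
   the normalized fraction N / S. *)
Definition left_qrat_pair (r s : int) (N : qfield) (S : {poly int}) : Prop :=
  exists a : seq int,
    [/\ even_cf r s a,
        is_laurent N,
        S.[0] = 1,
        exists (e : bool) (n : int),
          vec2 N S%:F = ((-1) ^+ e * q ^ n) *: (Mq a *m vec2 1 (1 - q)) &
        N / S%:F = left_qrat a].

(* q ^ (deg f) * f(q^-1), the degree of f being (size f).-1 *)
Definition reciprocal (f : {poly int}) : {poly int} :=
  \sum_(i < size f) f`_i *: 'X^((size f).-1 - i).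

Definition palindromic (f : {poly int}) : Prop := f = reciprocal f.

Fact laurent_identities (F : fieldType) (t x y z : F) (n k : nat) :
    t != 0 ->
  [/\ t ^- n * (1 * x + 0 * y) = t ^- n.+1 * (t * x),
      t ^- n * (1 * x + t^-1 * y) = t ^- n.+1 * (t * x + y),
      z * (t^-1 * x + - t^-1 * - (t ^+ k * y)) = z / t * (x + t ^+ k * y),
      z * (0 * x + 1 * - (t ^+ k * y)) = z / t * - (t ^+ k.+1 * y) &
      z * (- t * x + t * - (t ^+ k * y)) = z * - (t ^+ 1 * (x + t ^+ k * y))].
Proof.
move=> t0; have tn0 : t ^+ n != 0 by rewrite expf_neq0.
by split; rewrite ?exprS; field; rewrite ?t0 ?tn0.
Qed.

Lemma q_neq0 : q != 0.
Proof. by rewrite /q tofrac_eq0 polyX_eq0. Qed.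

Lemma onem_q_neq0 : 1 - q != 0.
Proof.
rewrite /q -tofrac1 -tofracB tofrac_eq0 -opprB oppr_eq0.
by rewrite -[1]/(1%:P) polyXsubC_eq0.
Qed.

Lemma mx22_mul_vec2 (a b c d x y : qfield) :
  mx22 a b c d *m vec2 x y = vec2 (a * x + b * y) (c * x + d * y).
Proof.
apply/colP=> i; rewrite !mxE !big_ord_recl big_ord0 !mxE /= addr0.
by case: eqP.
Qed.

Lemma scale_vec2 (k x y : qfield) : k *: vec2 x y = vec2 (k * x) (k * y).
Proof. by apply/colP=> i; rewrite !mxE; case: eqP. Qed.

Lemma vec2_inj (x y x' y' : qfield) :
  vec2 x y = vec2 x' y' -> x = x' /\ y = y'.
Proof. by move=> /colP e; have := (e 0, e 1); rewrite !mxE /= => -[]. Qed.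

Lemma mul_mx22 (a b c d a' b' c' d' : qfield) :
  mx22 a b c d * mx22 a' b' c' d' =
  mx22 (a * a' + b * c') (a * b' + b * d') (c * a' + d * c') (c * b' + d * d').
Proof.
apply/matrixP=> i j; rewrite !mxE !big_ord_recl big_ord0 !mxE /= addr0.
by case: eqP; case: eqP.
Qed.

Lemma mx22_1 : mx22 1 0 0 1 = 1.
Proof.
apply/matrixP=> -[[|[|//]] ?] [[|[|//]] ?]; by rewrite !mxE.
Qed.

Lemma mx22V (A B : 'M[qfield]_2) : A * B = 1 -> A^-1 = B.
Proof.
move=> AB1; have [uA _] := mulmx1_unit AB1.
by rewrite -[LHS]mulr1 -AB1 mulKr.
Qed.

Lemma RqV : Rq^-1 = mx22 q^-1 (- q^-1) 0 1.
Proof.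
apply: mx22V; rewrite mul_mx22 -mx22_1.
by rewrite !(mul0r, mulr0, mul1r, mulr1, addr0, add0r) mulrN mulfV ?q_neq0 // addNr.
Qed.

Lemma LqV : Lq^-1 = mx22 1 0 (- q) q.
Proof.
apply: mx22V; rewrite mul_mx22 -mx22_1.
by rewrite !(mul0r, mulr0, mul1r, mulr1, addr0, add0r) mulrN mulVf ?q_neq0 // subrr.
Qed.

(* Normal forms, up to a power of q, of the vectors M_q(a) (1, 1 - q) with
   nonnegative, resp. nonpositive, exponents; [pos_vec] and [neg_vec] are
   preserved by R_q, L_q, resp. by their inverses. *)
Definition pos_vec (v : 'cV[qfield]_2) : Prop :=
  exists (n : nat) (P Q : {poly int}),
    v = q ^- n *: vec2 P%:F Q%:F /\ Q.[0] = 1.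

Definition neg_vec (v : 'cV[qfield]_2) : Prop :=
  exists (n : int) (k : nat) (U W : {poly int}),
    [/\ v = q ^ n *: vec2 U%:F (- ('X^(k.+1) * W)%:F), U.[0] = 1 & W.[0] = 1].

Lemma pos_vecR v : pos_vec v -> pos_vec (Rq *m v).
Proof.
case=> n [P] [Q] [-> Q1]; exists n, ('X * P + Q), Q; split=> //.
by rewrite -scalemxAr mx22_mul_vec2 mul1r mul0r add0r tofracD tofracM.
Qed.

Lemma pos_vecL v : pos_vec v -> pos_vec (Lq *m v).
Proof.
case=> n [P] [Q] [-> Q1]; exists n.+1, ('X * P), ('X * P + Q); split; last first.
  by rewrite hornerD hornerM hornerX mul0r add0r.
rewrite -scalemxAr mx22_mul_vec2 !scale_vec2 !(tofracD, tofracM) -/q.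
by have [-> -> _ _ _] := laurent_identities P%:F Q%:F 0 n 0 q_neq0.
Qed.

Lemma neg_vecR v : neg_vec v -> neg_vec (Rq^-1 *m v).
Proof.
case=> n [k] [U] [W] [-> U1 W1].
exists (n - 1), k.+1, (U + 'X^(k.+1) * W), W; split=> //; last first.
  by rewrite hornerD hornerM hornerXn U1 expr0n mul0r addr0.
have q0 := q_neq0.
rewrite -scalemxAr RqV mx22_mul_vec2 !scale_vec2 !(tofracXn, tofracD, tofracM) -/q.
rewrite (expfzDr _ _ q0) -[q ^ (-1)]/(q^-1).
by have [_ _ -> -> _] := laurent_identities U%:F W%:F (q ^ n) 0 k.+1 q0.
Qed.

Lemma neg_vecL v : neg_vec v -> neg_vec (Lq^-1 *m v).
Proof.
case=> n [k] [U] [W] [-> U1 W1].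
exists n, 0, U, (U + 'X^(k.+1) * W); split=> //; last first.
  by rewrite hornerD hornerM hornerXn U1 expr0n mul0r addr0.
rewrite -scalemxAr LqV mx22_mul_vec2 !scale_vec2 !(tofracXn, tofracD, tofracM) -/q.
have [_ _ _ _ ->] := laurent_identities U%:F W%:F (q ^ n) 0 k.+1 q_neq0.
by rewrite mul1r mul0r addr0.
Qed.

Lemma neg_vecL0 : neg_vec (Lq^-1 *m vec2 1 (1 - q)).
Proof.
exists 0, 1%N, 1, 1; split; rewrite ?hornerC //.
rewrite LqV mx22_mul_vec2 scale_vec2 !(tofracXn, tofrac1, tofracM) -/q.
rewrite expr0z !(mul1r, mulr1, mul0r, addr0); congr vec2.
by rewrite mulrBr mulr1 addrA addNr add0r expr2.
Qed.

Lemma exprz_mul_vec (P : 'cV[qfield]_2 -> Prop) (A : 'M[qfield]_2) (n : nat) :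
  (forall v, P v -> P (A *m v)) -> forall v, P v -> P (A ^ n%:Z *m v).
Proof.
move=> PA; elim: n => [|n IHn] v Pv; first by rewrite expr0z mul1mx.
by rewrite exprSz -mulmxA; apply/PA/IHn.
Qed.

Lemma pos_vec_Mq (a : seq int) :
  all (fun c => 0 <= c) a -> pos_vec (Mq a *m vec2 1 (1 - q)).
Proof.
have [m] := ubnP (size a); elim: m a => // m IHm [|x [|y a]] /= le_am.
- move=> _; exists 0, 1, (1 - 'X); rewrite hornerD hornerN hornerX hornerC subr0; split=> //.
  by rewrite mul1mx expr0 invr1 scale1r tofracB tofrac1.
- move=> _; exists 0, 1, (1 - 'X); rewrite hornerD hornerN hornerX hornerC subr0; split=> //.
  by rewrite mul1mx expr0 invr1 scale1r tofracB tofrac1.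
case/and3P=> x0 y0 /IHm IHa; rewrite -!mulmxA.
case: x x0 => // x _; case: y y0 => // y _.
apply: (@exprz_mul_vec pos_vec Rq x pos_vecR).
apply: (@exprz_mul_vec pos_vec Lq y pos_vecL); apply: IHa.
by rewrite -ltnS; apply: ltn_trans le_am.
Qed.

Lemma neg_vec_Mq (a : seq int) :
  (0 < size a)%N -> ~~ odd (size a) -> head 0 a <= 0 ->
  all (fun c => c <= -1) (behead a) -> neg_vec (Mq a *m vec2 1 (1 - q)).
Proof.
have [m] := ubnP (size a); elim: m a => // m IHm [|x [|y a]] //= le_am _.
rewrite negbK => odd_a x0 /andP[y0 a0].
have Pvec (A : 'M[qfield]_2) (n : nat) v :
    (forall w, neg_vec w -> neg_vec (A^-1 *m w)) ->
    neg_vec v -> neg_vec (A ^ (- n%:Z) *m v).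
  by move=> PA; rewrite -exprz_inv; apply: (@exprz_mul_vec neg_vec A^-1).
have{x0} [n ->] : exists n : nat, x = - n%:Z by exists `|x|%N; lia.
have{y0} [k ->] : exists k : nat, y = - k.+1%:Z by exists `|y|.-1%N; lia.
rewrite -!mulmxA; apply: (Pvec _ _ _ neg_vecR).
case: a odd_a a0 le_am => [|x' [|y' a]] //= odd_a a0 le_am.
  rewrite mul1mx -exprz_inv exprSzr -[_ * _]/(_ *m _) -mulmxA.
  exact/(@exprz_mul_vec neg_vec Lq^-1 k neg_vecL)/neg_vecL0.
apply: (Pvec _ _ _ neg_vecL); apply: (IHm [:: x', y' & a]) => //=; try lia.
Qed.

Fact moebius_identity (F : fieldType) (a b c d t k : F) :
    k != 0 -> t != 0 -> k * (c * 1 + d * t) != 0 ->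
  k * (a * 1 + b * t) / (k * (c * 1 + d * t)) =
  (a * (1 / t) + b) / (c * (1 / t) + d).
Proof.
move=> k0 t0; rewrite mulf_eq0 negb_or => /andP[_ d0].
rewrite -mulf_div divff // mul1r.
have -> : a * (1 / t) + b = (a * 1 + b * t) / t by field.
have -> : c * (1 / t) + d = (c * 1 + d * t) / t by field.
by rewrite invf_div mulrA divfK.
Qed.

Lemma left_qrat_pair_vec (r s : int) (a : seq int) (N : qfield)
    (S : {poly int}) (e : bool) (n : int) :
  even_cf r s a -> is_laurent N -> S.[0] = 1 ->
  vec2 N S%:F = ((-1) ^+ e * q ^ n) *: (Mq a *m vec2 1 (1 - q)) ->
  left_qrat_pair r s N S.
Proof.
move=> cf_a N_laurent S1 NS; exists a; split=> //; first by exists e, n.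
have c0 : (-1) ^+ e * q ^ n != 0 :> qfield.
  by rewrite mulf_neq0 ?signr_eq0 // expfz_neq0 // q_neq0.
have S0 : S%:F != 0 :> qfield.
  rewrite tofrac_eq0; apply/eqP=> S0; move: S1.
  by rewrite S0 horner0 => /esym/eqP; rewrite oner_eq0.
move: NS c0; set c := _ * _; move: c => c.
have -> : Mq a = mx22 (Mq a 0 0) (Mq a 0 1) (Mq a 1 0) (Mq a 1 1).
  by apply/matrixP=> -[[|[|//]] ?] [[|[|//]] ?]; rewrite !mxE /=;
    congr (Mq a _ _); apply: val_inj.
rewrite /left_qrat /moebius mx22_mul_vec2 scale_vec2 => /vec2_inj[-> S_eq] c0.
rewrite S_eq in S0 *; move: onem_q_neq0 c0 S0.
move: (Mq a 0 0) (Mq a 0 1) (Mq a 1 0) (Mq a 1 1) (1 - q) => x y z t u u0 c0 S0.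
exact: (@moebius_identity qfield x y z t u c c0 u0 S0).
Qed.

Lemma pos_even_cf (r s : nat) : (0 < r)%N -> (0 < s)%N ->
  exists a : seq int,
    [/\ (0 < size a)%N, ~~ odd (size a), cf_value a = r%:R / s%:R,
        all (fun c => 1 <= c) (behead a) &
        (0 <= head 0 a) /\ ((s < r)%N -> 1 <= head 0 a)].
Proof.
have [m] := ubnP s; elim: m r s => // m IHm r s le_sm r0 s0.
have s0Q : s%:R != 0 :> rat by rewrite pnatr_eq0 -lt0n.
have := divn_eq r s; have := ltn_pmod r s0.
set b := (r %/ s)%N; set t := (r %% s)%N => lt_ts def_r.
have [t0|t0] := posnP t.
  exists [:: b%:Z - 1; 1]; split=> //=.
  - rewrite def_r t0 addn0 natrM mulfK // invr0 addr0 invr1 rmorphB /=.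
    by rewrite -pmulrn subrK.
  - by rewrite def_r t0 addn0; case: (b) def_r => [|[|b']] ?; nia.
have t0Q : t%:R != 0 :> rat by rewrite pnatr_eq0 -lt0n.
have := divn_eq s t; have := ltn_pmod s t0.
set c := (s %/ t)%N; set u := (s %% t)%N => lt_ut def_s.
have c0 : (0 < c)%N by rewrite divn_gt0 // ltnW.
have b1 : (s < r)%N -> 1 <= b%:Z.
  by move=> sr; rewrite lez_nat divn_gt0 // ltnW.
have [u0|u0] := posnP u.
  exists [:: b%:Z; c%:Z]; split=> //=; last by rewrite andbT lez_nat.
  rewrite -!pmulrn invr0 addr0.
  rewrite def_r natrD natrM mulrDl mulfK //; congr (_ + _).
  by rewrite def_s u0 addn0 natrM invfM mulrCA mulfV ?mulr1.
have u0Q : u%:R != 0 :> rat by rewrite pnatr_eq0 -lt0n.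
have [|a [sz_a odd_a val_a all_a [_ hd_a]]] := IHm t u _ t0 u0.
  exact: ltn_trans lt_ut (leq_trans lt_ts le_sm).
exists [:: b%:Z, c%:Z & a]; split=> //=; first by rewrite negbK.
- rewrite -/(cf_value a) val_a invf_div -!pmulrn.
  have s_eq : c%:R + u%:R / t%:R = s%:R / t%:R :> rat.
    by rewrite [in RHS]def_s natrD natrM mulrDl mulfK.
  by rewrite s_eq invf_div [in RHS]def_r natrD natrM mulrDl mulfK.
- case: a sz_a all_a hd_a {odd_a val_a} => //= x a _ -> -> //.
  by rewrite lez_nat c0.
Qed.

Lemma cf_valueN (a : seq int) : cf_value (map -%R a) = - cf_value a.
Proof.
elim: a => [|c a IHa] /=; first by rewrite oppr0.
by rewrite IHa rmorphN invrN opprD.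
Qed.

Lemma even_cf_exists (r s : int) : 0 < s -> exists a, even_cf r s a.
Proof.
case: s => // s s0.
have [r0|r0|->] := ltrgt0P r; last first.
- by exists [:: -1; 1]; split=> //=; rewrite mul0r.
- have [||a [sz odd_a val_a all_a [hd_a _]]] := @pos_even_cf `|r| s; try lia.
  exists (map -%R a); split; rewrite ?size_map //.
    rewrite cf_valueN val_a -mulNr; congr (_ / _).
    by rewrite -[in RHS](opprK r) rmorphN /= -(ltr0_norm r0).
  split=> [|_|]; try lia; case: a sz hd_a all_a {odd_a val_a} => //= x a _ x0.
  move=> all_a; split; first by lia.
  by rewrite all_map; apply: sub_all all_a => c /= c1; lia.
- have [||a [sz odd_a val_a all_a [hd_a _]]] := @pos_even_cf `|r| s; try lia.
  exists a; split=> //; last by split=> //; lia.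
  by rewrite val_a -[in RHS](gtr0_norm r0).
Qed.

Fact normalize_identities (F : fieldType) (y z u w : F) :
    y != 0 -> z != 0 ->
  (-1) ^+ 1 * (z^-1 * y^-1) * (y * u) = z^-1 * - u /\
  (-1) ^+ 1 * (z^-1 * y^-1) * (y * - (z * w)) = w.
Proof. by move=> y0 z0; split; field; rewrite y0 z0. Qed.

Fact zero_identities (F : fieldType) (t : F) :
    t != 0 ->
  t * (t^-1 * (1 * 1 + 0 * (1 - t)) + - t^-1 * (1 * 1 + t^-1 * (1 - t))) =
    t ^- 1 * (t - 1) /\
  t * (0 * (1 * 1 + 0 * (1 - t)) + 1 * (1 * 1 + t^-1 * (1 - t))) = 1.
Proof. by move=> t0; split; field. Qed.

(* The relation is inhabited for every fraction with positive denominator, so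
   assuming [left_qrat_pair r s N S] is never vacuous. *)
Lemma left_qrat_pair_exists (r s : int) :
  0 < s -> exists (N : qfield) (S : {poly int}), left_qrat_pair r s N S.
Proof.
move=> s0; have [a cf_a] := even_cf_exists r s0.
have [sz_a odd_a _ [pos_a neg_a zero_a]] := cf_a.
have q0 := q_neq0.
have neg_case : neg_vec (Mq a *m vec2 1 (1 - q)) ->
    exists (N : qfield) (S : {poly int}), left_qrat_pair r s N S.
  case=> n [k [U [W [eq_a U1 W1]]]].
  exists (q ^- k.+1 * (- U)%:F), W.
  apply: (left_qrat_pair_vec (e := true) (n := - k.+1%:Z - n) cf_a) => //.
    by exists (- U), k.+1.
  rewrite eq_a !scale_vec2 expfzDr // -exprnN -invr_expz.
  rewrite !(tofracXn, tofracN, tofracM) -/q.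
  have qn0 : q ^ n != 0 by rewrite expfz_neq0.
  have qk0 : q ^+ k.+1 != 0 := expf_neq0 k.+1 q0.
  move: (U%:F) (W%:F) (q ^ n) (q ^+ k.+1) qn0 qk0 => u w y z y0 z0.
  by have [-> ->] := @normalize_identities qfield y z u w y0 z0.
have pos_case : pos_vec (Mq a *m vec2 1 (1 - q)) ->
    exists (N : qfield) (S : {poly int}), left_qrat_pair r s N S.
  case=> n [P [Q [eq_a Q1]]]; exists P%:F, Q.
  apply: (left_qrat_pair_vec (e := false) (n := n) cf_a) => //.
    by exists P, 0%N; rewrite expr0 invr1 mul1r.
  rewrite eq_a scalerA -exprnP expr0 mul1r.
  have qn0 : q ^+ n != 0 := expf_neq0 n q0.
  by rewrite mulfV // scale1r.
have [r0|r0|r0] := ltrgt0P r.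
- apply/pos_case/pos_vec_Mq; have [] := pos_a r0.
  case: a sz_a {cf_a odd_a pos_a neg_a zero_a neg_case pos_case} => //= x a _.
  by move=> -> /=; apply: sub_all => c; lia.
- by have [hd_a all_a] := neg_a r0; apply/neg_case/neg_vec_Mq.
exists (q ^- 1 * ('X - 1)%:F), 1.
apply: (left_qrat_pair_vec (e := false) (n := 1) cf_a); rewrite ?hornerC //.
  by exists ('X - 1), 1%N.
rewrite (zero_a r0) /= !mulmx1 -mulmxA.
rewrite expr1z exprN1 RqV /Lq.
rewrite mx22_mul_vec2 mx22_mul_vec2 scale_vec2.
rewrite tofracB tofrac1 -/q expr0 !(mul1r q).
move: (q) q0 => t t0.
have [e1 e2] := @zero_identities qfield t t0.
by congr vec2; [exact: (esym e1) | exact: (esym e2)].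
Qed.

(* Main.v *)
Require Import Defs.
From HB Require Import structures.
From mathcomp Require Import all_boot all_order all_algebra.
From mathcomp Require Import fraction ring lra zify.
Import Order.TTheory GRing.Theory Num.Theory.
Local Open Scope ring_scope.

(** Write the expansion of [r/s] as a word in the two letters R and L. Up to a
    unit [+- q^n], the denominator [S] is the bottom entry
    [den q w = W10 + (1 - q) W11] of [W (1, 1-q)], where [W] is the product of
    the letters [R = (q 1; 0 1)] and [q L_q = (q 0; q 1)]; for negative [r/s]
    it is [den q^-1 w] instead ([left_qrat_den]). At [q = 1] the product becomes
    an integer matrix [(a b; c d)] of determinant 1 with [c = s] and
    [a = +- r] modulo [s]. As [S(0) = 1], palindromicity of [S] means that [S(q)]
    and [S(1/q)] differ by a power of [q], a property which passes from [S] to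
    [den] ([self_reciprocal_sim], [self_reciprocal_simV]). So it has to be shown
    that [den q w] and [den q^-1 w] differ by a power of [q] if and only if [c]
    divides [a^2 + 1]; since [ad - bc = 1], this means that [c] divides [a + d]
    ([dvdz_trace]).

    Only if. A first-order deformation of the modular group is inner up to
    scalars, so that [2 W'(1) = n W + [J, W]] for a constant matrix [J], [n]
    being the length of the word ([deriv_word_mx]). Consequently
    [2 den'(1) = (n + 1) c - (a + d)] ([deriv_den]). On the other hand
    [den(q) = q^k den(1/q)] gives [2 den'(1) = k den(1) = k c]
    ([self_reciprocal_deriv]), hence [c] divides [a + d]. This is the principle
    by which a Dedekind sum [s(r, s)] with [12 s(r, s)] an integer detects
    [r^2 = -1 mod s].

    If. Powers of R at the beginning of [w] do not change [den], and, apart from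
    the trivial word L, what remains is [L v L] for a word [v]. The divisibility
    and the sizes of the entries force the integer matrix of [v] to be symmetric;
    since R and L freely generate a monoid ([word_mx1_inj]), [v] is then invariant
    under reversal combined with exchange of the letters ([dvdz_self_dual]).
    Finally, one fixed matrix intertwines [W(q)] and [q^n W(1/q)] ([word_mx_inv]),
    which expresses [den q^-1 (L v L)] through the entries for [v] at [q]; for
    an invariant word the result is [den q (L v L)] up to a power of [q]
    ([den_self_dual]). *)

Set Implicit Arguments.
Unset Strict Implicit.
Unset Printing Implicit Defensive.

(** * Two by two matrices *)

Definition mat2 (K : nzRingType) (a b c d : K) : 'M[K]_2 :=
  \matrix_(i < 2, j < 2)
    if i == 0 then (if j == 0 then a else b) else (if j == 0 then c else d).

Lemma mat2_eq (K : nzRingType) (A B : 'M[K]_2) :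
  A 0 0 = B 0 0 -> A 0 1 = B 0 1 -> A 1 0 = B 1 0 -> A 1 1 = B 1 1 -> A = B.
Proof.
move=> e00 e01 e10 e11; apply/matrixP=> i j.
have ord2 (k : 'I_2) : (k = 0) \/ (k = 1).
  by case: k => -[|[|//]] ?; [left | right]; apply: val_inj.
by case: (ord2 i) => ->; case: (ord2 j) => ->.
Qed.

Lemma mulmx2E (K : nzRingType) m n (A : 'M[K]_(m, 2)) (B : 'M[K]_(2, n)) i j :
  (A *m B) i j = A i 0 * B 0 j + A i 1 * B 1 j.
Proof.
by rewrite mxE big_ord_recl big_ord1; congr (_ + A i _ * B _ j); apply: val_inj.
Qed.

Lemma mul2E (K : nzRingType) (A B : 'M[K]_2) i j :
  (A * B) i j = A i 0 * B 0 j + A i 1 * B 1 j.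
Proof. exact: mulmx2E. Qed.

Lemma scale2E (K : nzRingType) (k : K) (A : 'M[K]_2) i j :
  (k *: A) i j = k * A i j.
Proof. by rewrite mxE. Qed.

Lemma mat2E (K : nzRingType) (a b c d : K) :
  (mat2 a b c d 0 0 = a) * (mat2 a b c d 0 1 = b) *
  (mat2 a b c d 1 0 = c) * (mat2 a b c d 1 1 = d).
Proof. by rewrite !mxE. Qed.

Lemma one2E (K : nzRingType) :
  ((1 : 'M[K]_2) 0 0 = 1) * ((1 : 'M[K]_2) 0 1 = 0) *
  ((1 : 'M[K]_2) 1 0 = 0) * ((1 : 'M[K]_2) 1 1 = 1).
Proof. by rewrite !mxE. Qed.

(** * Words in R and L *)

(** Multiplying the second letter [(1 0; 1 t^-1)] by [t] makes its entries
    polynomials in [t] and gives both letters determinant [t]. *)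
Definition letter (K : nzRingType) (t : K) (b : bool) : 'M[K]_2 :=
  if b then mat2 t 1 0 1 else mat2 t 0 t 1.

Definition word_mx (K : nzRingType) (t : K) (w : seq bool) : 'M[K]_2 :=
  \prod_(b <- w) letter t b.

(** The bottom entry of [word_mx t w *m (1, 1 - t)]. Both the vector
    [(1, 1 - t)] and the row [(0, 1)] are fixed by R. *)
Definition den (K : nzRingType) (t : K) (w : seq bool) : K :=
  word_mx t w 1 0 + word_mx t w 1 1 * (1 - t).

Definition dual (w : seq bool) : seq bool := rev (map negb w).

Section Words.
Variable K : comNzRingType.
Implicit Types (t u : K) (w : seq bool).

Lemma word_mx_nil t : word_mx t [::] = 1.
Proof. by rewrite /word_mx big_nil. Qed.

Lemma word_mx_cons t b w : word_mx t (b :: w) = letter t b * word_mx t w.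
Proof. by rewrite /word_mx big_cons. Qed.

Lemma word_mx_cat t w w' : word_mx t (w ++ w') = word_mx t w * word_mx t w'.
Proof. by rewrite /word_mx big_cat. Qed.

Lemma word_mx_rcons t w b : word_mx t (rcons w b) = word_mx t w * letter t b.
Proof. by rewrite -cats1 word_mx_cat /word_mx big_seq1. Qed.

Lemma word_mx_nseq t n b : word_mx t (nseq n b) = letter t b ^+ n.
Proof.
by elim: n => [|n IHn]; rewrite ?word_mx_nil // word_mx_cons IHn exprS.
Qed.

Lemma word_mx_consE t w :
  (forall j, word_mx t (true :: w) 0 j
             = t * word_mx t w 0 j + word_mx t w 1 j) *
  (forall j, word_mx t (true :: w) 1 j = word_mx t w 1 j) *
  (forall j, word_mx t (false :: w) 0 j = t * word_mx t w 0 j) *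
  (forall j, word_mx t (false :: w) 1 j
             = t * word_mx t w 0 j + word_mx t w 1 j).
Proof.
by split; [split; [split|]|] => j; rewrite word_mx_cons mul2E !mat2E; ring.
Qed.

(** Conjugation by [(1 0; 0 t)] turns transposition into the anti-automorphism
    that exchanges the two letters. *)
Lemma word_mx_dual t w :
  word_mx t (dual w) * mat2 1 0 0 t = mat2 1 0 0 t * (word_mx t w)^T.
Proof.
elim: w => [|b w IHw]; first by rewrite !word_mx_nil trmx1 mul1r mulr1.
rewrite /dual /= rev_cons word_mx_rcons word_mx_cons -/(dual w) -mulrA.
rewrite -[(_ * word_mx t w)^T]/((_ *m word_mx t w)^T) trmx_mul.
have -> : letter t (~~ b) * mat2 1 0 0 t = mat2 1 0 0 t * (letter t b)^T.
  by case: b; apply: mat2_eq; rewrite !mul2E !mat2E ![trmx _ _ _]mxE !mat2E; ring.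
by rewrite mulrA IHw -mulrA.
Qed.

Lemma det_word_mx t w :
  word_mx t w 0 0 * word_mx t w 1 1 - word_mx t w 0 1 * word_mx t w 1 0 =
  t ^+ size w.
Proof.
elim: w => [|b w IHw]; first by rewrite word_mx_nil !one2E expr0; ring.
by rewrite /= exprS -IHw; case: b; rewrite !word_mx_consE; ring.
Qed.

Lemma den_true t j w : den t (nseq j true ++ w) = den t w.
Proof. by elim: j => //= j <-; rewrite /den !word_mx_consE. Qed.

Lemma den_false t w :
  den t (false :: rcons w false) =
  t ^+ 2 * word_mx t w 0 0 + t * (word_mx t w 0 1 + word_mx t w 1 0)
  + word_mx t w 1 1.
Proof. by rewrite /den !word_mx_consE word_mx_rcons !mul2E !mat2E; ring. Qed.

(** The reversal of a word has two descriptions up to conjugation by a fixed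
    matrix: transposing the matrix of the word, and inverting the matrix of the
    word at [t^-1]. As inversion is, up to conjugation, transposition divided by
    the determinant [t ^- n], a single [Z] intertwines [W(t)] with
    [t^n W(t^-1)]. *)
Lemma word_mx_inv t u w (Z := mat2 t (1 - t) (t - 1) 1) : t * u = 1 ->
  Z * word_mx t w = t ^+ size w *: (word_mx u w * Z).
Proof.
move=> tu; elim: w => [|b w IHw].
  by rewrite !word_mx_nil mulr1 mul1r expr0 scale1r.
have Zb : Z * letter t b = t *: (letter u b * Z).
  by case: b; apply: mat2_eq; rewrite scale2E !mul2E !mat2E; ring: tu.
rewrite !word_mx_cons mulrA Zb -scalerAl -(mulrA (letter u b) Z) IHw.
by rewrite -scalerAr scalerA mulrA exprS.
Qed.

(** The intertwiner maps the column [(1, 1)] to [(1, t)] and the row [(1, t)]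
    to [(t^2, 1)]; up to the factor [t^-2], the value of [den t^-1] at [L w L] is
    that of the matrix of [w] at [t^-1] between the row and the column [(1, t)]. *)
Lemma den_inv t u w : t * u = 1 ->
  t ^+ (size w).+2 * den u (false :: rcons w false) =
  t ^+ 2 * (word_mx t w 0 0 + word_mx t w 0 1)
  + (word_mx t w 1 0 + word_mx t w 1 1).
Proof.
move=> tu; rewrite den_false.
have /matrixP e := word_mx_inv w tu.
have := (e 0 0, e 0 1, e 1 0, e 1 1).
rewrite !scale2E !mul2E !mat2E => -[[[e00 e01] e10] e11].
transitivity (t ^+ size w * (word_mx u w 0 0 + t * (word_mx u w 0 1 +
    word_mx u w 1 0) + t ^+ 2 * word_mx u w 1 1)); last first.
  (* The sum of the first two equations plus t times the sum of the others. *)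
  transitivity
    ((t ^+ size w * (word_mx u w 0 0 * t + word_mx u w 0 1 * (t - 1))
      + t ^+ size w * (word_mx u w 0 0 * (1 - t) + word_mx u w 0 1 * 1))
     + t * (t ^+ size w * (word_mx u w 1 0 * t + word_mx u w 1 1 * (t - 1))
      + t ^+ size w * (word_mx u w 1 0 * (1 - t) + word_mx u w 1 1 * 1))).
    ring.
  by rewrite -e00 -e01 -e10 -e11; ring.
rewrite !exprS; ring: tu.
Qed.

(** Self-duality of [w] gives [W10 = t W01], which makes the right-hand sides
    of [den_false] and [den_inv] equal. *)
Lemma den_self_dual t u w : t * u = 1 -> dual w = w ->
  den t (false :: rcons w false) =
  t ^+ (size w).+2 * den u (false :: rcons w false).
Proof.
move=> tu w_dual; rewrite den_inv // den_false.
have := word_mx_dual t w; rewrite w_dual => /matrixP /(_ 0 1).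
rewrite !mul2E !mat2E ![trmx _ _ _]mxE => e.
have -> : word_mx t w 1 0 = word_mx t w 0 1 * t.
  by move: e; rewrite !mul0r mulr0 add0r addr0 mul1r => ->.
ring.
Qed.

End Words.

Section BaseChange.
Variables (K K' : comNzRingType) (f : {rmorphism K -> K'}).

Lemma map_word_mx t w : map_mx f (word_mx t w) = word_mx (f t) w.
Proof.
elim: w => [|b w IHw]; first by rewrite !word_mx_nil map_mx1.
rewrite !word_mx_cons [LHS]map_mxM IHw; congr (_ * _).
by case: b; apply: mat2_eq; rewrite [LHS]mxE !mat2E ?rmorph0 ?rmorph1.
Qed.

Lemma rmorph_word_mx t w i j : f (word_mx t w i j) = word_mx (f t) w i j.
Proof. by rewrite -map_word_mx mxE. Qed.

Lemma rmorph_den t w : f (den t w) = den (f t) w.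
Proof. by rewrite /den rmorphD rmorphM rmorphB rmorph1 !rmorph_word_mx. Qed.

End BaseChange.

Lemma horner_word_mx w i j (x : int) : (word_mx 'X w i j).[x] = word_mx x w i j.
Proof.
by rewrite -[LHS]/(horner_eval x _) rmorph_word_mx /= /horner_eval hornerX.
Qed.

Lemma horner_den w (x : int) : (den 'X w).[x] = den x w.
Proof. by rewrite -[LHS]/(horner_eval x _) rmorph_den /= /horner_eval hornerX. Qed.

(** * The derivative at 1 *)

(** Entry by entry, this is [2 W'(1) = n W + (J W - W J)] with
    [J = (0 1; -1 1)]. The equation holds for both letters, with [n = 1], and
    its right-hand side obeys the Leibniz rule. *)
Lemma deriv_word_mx w (D := fun i j => (word_mx 'X w i j)^`().[1 : int])
    (W := word_mx (1 : int) w) (n := (size w)%:R : int) :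
  [/\ D 0 0 *+ 2 = n * W 0 0 + (W 1 0 + W 0 1),
      D 0 1 *+ 2 = n * W 0 1 + (W 1 1 - W 0 0 - W 0 1),
      D 1 0 *+ 2 = n * W 1 0 + (W 1 0 + W 1 1 - W 0 0) &
      D 1 1 *+ 2 = n * W 1 1 - (W 0 1 + W 1 0)].
Proof.
rewrite {}/D {}/W {}/n; elim: w => [|b w [IH00 IH01 IH10 IH11]].
  by rewrite !word_mx_nil !one2E (derivC 1) (derivC 0) horner0 /=; split; ring.
rewrite /= -natr1; case: b; rewrite !word_mx_consE !mul1r.
all: rewrite ?derivD ?derivM ?derivX ?hornerD ?hornerM ?hornerX ?horner_word_mx.
all: rewrite ?hornerC !mul1r.
all: by split; rewrite ?[(_ + _) *+ 2]mulrnDl ?IH00 ?IH01 ?IH10 ?IH11; ring.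
Qed.

Lemma deriv_den w (W := word_mx (1 : int) w) :
  (den 'X w)^`().[1] *+ 2 = (size w).+1%:R * W 1 0 - (W 0 0 + W 1 1).
Proof.
have [_ _ D10 _] := deriv_word_mx w.
have h1 : (1 - 'X : {poly int}).[1] = 0 by rewrite !hornerE subrr.
have h2 : (0 - 1 : {poly int}).[1] = -1 by rewrite !hornerE.
rewrite /den derivD derivM derivB (derivC 1) derivX !hornerD !hornerM h1 h2.
by rewrite horner_word_mx mulr0 add0r mulrN1 mulrnBl D10 -/W -natr1; ring.
Qed.

(** * Integer matrices of words *)

Lemma word_mx1_ge0 w i j : 0 <= word_mx (1 : int) w i j.
Proof.
elim: w i j => [|b w IHw] i j; first by rewrite word_mx_nil mxE ler0n.
rewrite word_mx_cons mul2E addr_ge0 ?mulr_ge0 //.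
  by case: b; rewrite mxE; case: eqP => ? /=.
by case: b; rewrite mxE; case: eqP => ? /=.
Qed.

Lemma word_mx1_det w :
  word_mx (1 : int) w 0 0 * word_mx 1 w 1 1
  - word_mx (1 : int) w 0 1 * word_mx 1 w 1 0 = 1.
Proof. by rewrite det_word_mx expr1n. Qed.

Lemma word_mx1_consE w (W := word_mx (1 : int) w) :
  (forall j, word_mx (1 : int) (true :: w) 0 j = W 0 j + W 1 j) *
  (forall j, word_mx (1 : int) (true :: w) 1 j = W 1 j) *
  (forall j, word_mx (1 : int) (false :: w) 0 j = W 0 j) *
  (forall j, word_mx (1 : int) (false :: w) 1 j = W 0 j + W 1 j).
Proof. by split; [split; [split|]|] => j; rewrite word_mx_consE ?mul1r. Qed.

Lemma word_mx1_nseq j w :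
  (forall i, word_mx (1 : int) (nseq j true ++ w) 0 i
             = word_mx 1 w 0 i + j%:Z * word_mx 1 w 1 i) *
  (forall i, word_mx (1 : int) (nseq j true ++ w) 1 i = word_mx 1 w 1 i) *
  (forall i, word_mx (1 : int) (nseq j false ++ w) 0 i = word_mx 1 w 0 i) *
  (forall i, word_mx (1 : int) (nseq j false ++ w) 1 i
             = j%:Z * word_mx 1 w 0 i + word_mx 1 w 1 i).
Proof.
elim: j => [|j IHj].
  by split; [split; [split|]|] => i; rewrite ?mul0r ?addr0 ?add0r.
split; [split; [split|]|] => i; rewrite /= word_mx1_consE !IHj //.
all: by rewrite intS; ring.
Qed.

Lemma word_mx1_coprime w :
  coprimez (word_mx (1 : int) w 0 0) (word_mx 1 w 1 0).
Proof.
apply/coprimezP; exists (word_mx 1 w 1 1, - word_mx (1 : int) w 0 1) => /=.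
by rewrite -[RHS](word_mx1_det w); ring.
Qed.

(** R and L generate a free monoid: the first letter of a nonempty word can be
    read off, as the top row dominates the bottom row for R and is dominated
    by it for L, while a determinant 1 excludes both. *)
Lemma word_mx1_inj : injective (word_mx (1 : int)).
Proof.
have neRL w w' : word_mx (1 : int) (true :: w) <> word_mx 1 (false :: w').
  move/matrixP=> e; have := (e 0 0, e 1 0, e 0 1, e 1 1).
  rewrite !word_mx1_consE => -[[[e00 e10] e01] e11].
  have dw := word_mx1_det w.
  have [[g1 g2] [h1 h2]] := (word_mx1_ge0 w' 1 0, word_mx1_ge0 w' 1 1,
    (word_mx1_ge0 w 0 0, word_mx1_ge0 w 0 1)).
  have z0 : word_mx (1 : int) w 0 0 = 0 by lia.
  have z1 : word_mx (1 : int) w 0 1 = 0 by lia.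
  by move: dw; rewrite z0 z1 !mul0r.
have ne0 b w : word_mx (1 : int) [::] <> word_mx 1 (b :: w).
  move/matrixP=> e; have := (e 0 0, e 1 0, e 0 1, e 1 1).
  have [[g1 g2] g3] :=
    (word_mx1_ge0 w 0 0, word_mx1_ge0 w 0 1, word_mx1_ge0 w 1 0).
  case: b {e}; rewrite !word_mx1_consE word_mx_nil !one2E => -[[[e00 e10] e01] e11].
    by lia.
  by lia.
elim=> [|b w IHw] [|b' w'] //.
- by move/ne0.
- by move/esym/ne0.
have [<-|] := eqVneq b b'; last first.
  by case: b b' => -[] // _ => [/neRL|/esym/neRL].
move=> e; congr (_ :: _); apply: IHw; move/matrixP: e => e.
have := (e 0 0, e 1 0, e 0 1, e 1 1); case: b {e}; rewrite !word_mx1_consE.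
all: by move=> -[[[e00 e10] e01] e11]; apply: mat2_eq; lia.
Qed.

Lemma sym_self_dual w :
  word_mx (1 : int) w 0 1 = word_mx 1 w 1 0 -> dual w = w.
Proof.
move=> sym; apply: word_mx1_inj.
have I2 : mat2 1 0 0 1 = 1 :> 'M[int]_2.
  by apply: mat2_eq; rewrite !mat2E !one2E.
have := word_mx_dual (1 : int) w; rewrite I2 mulr1 mul1r => ->.
by apply: mat2_eq; rewrite mxE.
Qed.

(** If [(a b; c d)] is the matrix of [w], that of [L w L] has bottom left entry
    [a + b + c + d] and trace [a + 2b + d]. They differ by [c - b], which is too
    small to be a nonzero multiple of [a + b + c + d]. *)
Lemma dvdz_self_dual w (W := word_mx (1 : int) (false :: rcons w false))
    (a := W 0 0) (c := W 1 0) (d := W 1 1) :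
  (c %| a + d)%Z -> dual w = w.
Proof.
rewrite /a /c /d /W !word_mx1_consE !word_mx_rcons !mul2E !mat2E => {W a c d}.
have [d0 [[g1 g2] [g3 g4]]] := (word_mx1_det w, ((word_mx1_ge0 w 0 0,
  word_mx1_ge0 w 0 1), (word_mx1_ge0 w 1 0, word_mx1_ge0 w 1 1))).
move=> /dvdzP[k hk]; apply: sym_self_dual.
move: (word_mx 1 w 0 0) (word_mx 1 w 0 1) (word_mx 1 w 1 0) (word_mx 1 w 1 1)
  d0 g1 g2 g3 g4 hk => a b c d d0 g1 g2 g3 g4 hk.
have ad : 0 < a + d by nia.
have {}hk : c - b = (1 - k) * (a + b + c + d) by lia.
have k1 : 1 - k = 0.
  by have [m0|m0|//] := ltrgtP (1 - k) 0;
    move: hk; set m := 1 - k in m0 *; nia.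
by move: hk; rewrite k1 mul0r; lia.
Qed.

(** Modulo [c], [d] is inverse to [a]. *)
Lemma dvdz_trace (a b c d : int) : a * d - b * c = 1 ->
  (c %| a ^+ 2 + 1)%Z = (c %| a + d)%Z.
Proof.
move=> ad.
apply/idP/idP => /dvdzP[k hk]; apply/dvdzP.
  exists (d * k - a * b).
  have -> : a + d = d * (a ^+ 2 + 1) - a * (a * d - b * c - 1) - a * b * c.
    by ring.
  by rewrite hk ad; ring.
exists (a * k - b).
have -> : a ^+ 2 + 1 = a * (a + d) - (a * d - b * c - 1) - b * c by ring.
by rewrite hk ad; ring.
Qed.

(** * Palindromic polynomials *)

Lemma int_subn (m : int) : exists a b : nat, m = b%:Z - a%:Z.
Proof. by case: m => n; [exists 0%N, n | exists n.+1, 0%N]; lia. Qed.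

Definition ev (K : fieldType) (x : K) (p : {poly int}) : K :=
  (map_poly intr p).[x].

HB.instance Definition _ (K : fieldType) (x : K) :=
  GRing.RMorphism.copy (ev x) (horner_eval x \o map_poly intr).

Section Evaluation.
Variable K : fieldType.
Implicit Types (x : K) (p : {poly int}).

Lemma evX x : ev x 'X = x.
Proof. by rewrite /ev map_polyX hornerX. Qed.

Lemma ev_den x w : ev x (den 'X w) = den x w.
Proof. by rewrite rmorph_den /= evX. Qed.

Lemma evE x p : ev x p = \sum_(i < size p) (p`_i)%:~R * x ^+ i.
Proof.
rewrite -[in LHS](coefK p) poly_def rmorph_sum; apply: eq_bigr => i _ /=.
by rewrite -mul_polyC rmorphM rmorphXn /= evX /ev map_polyC hornerC.
Qed.

Lemma ev_reciprocal x p : x != 0 ->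
  ev x (reciprocal p) = x ^+ (size p).-1 * ev x^-1 p.
Proof.
move=> x0; rewrite [ev x^-1 p]evE mulr_sumr /reciprocal rmorph_sum.
apply: eq_bigr => i _ /=.
rewrite -mul_polyC rmorphM rmorphXn /= evX /ev map_polyC hornerC /=.
have le_i : (i <= (size p).-1)%N.
  by rewrite -ltnS prednK ?(leq_trans _ (ltn_ord i)).
rewrite mulrCA exprVn -[in RHS](subnK le_i) exprD -mulrA mulfV ?mulr1 //.
by rewrite expf_neq0.
Qed.

End Evaluation.

Lemma tofrac_ev p : tofrac p = ev q p.
Proof.
rewrite evE -[in LHS](coefK p) poly_def rmorph_sum; apply: eq_bigr => i _ /=.
rewrite -mul_polyC tofracM tofracXn; congr (_ * _).
by rewrite -[p`_i in LHS]intz rmorph_int /= rmorph_int.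
Qed.

Lemma ev_q_inj : injective (ev q).
Proof. by move=> p g; rewrite -!tofrac_ev => /eqP; rewrite tofrac_eq => /eqP. Qed.

(** A form of palindromicity which is not affected by units [+- q^n]. The field
    is left abstract, with [q] assumed transcendental below, so that identities
    are settled without unfolding the construction of a field of fractions. *)
Definition self_reciprocal (K : fieldType) (q : K) (p : {poly int}) : Prop :=
  exists k : int, ev q p = q ^ k * ev q^-1 p.

Section SelfReciprocal.
Variables (K : fieldType) (q : K).
Hypotheses (q0 : q != 0) (ev_inj : injective (ev q)).

(** The substitution [q -> 1/q] preserves relations up to a unit. *)
Lemma ev_inv (e : bool) (m : int) p g :
  ev q p = (-1) ^+ e * q ^ m * ev q g ->
  ev q^-1 p = (-1) ^+ e * q ^ (- m) * ev q^-1 g.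
Proof.
have [a [b ->]] := int_subn m => pg.
have qa0 (k : nat) : q ^+ k != 0 by rewrite expf_neq0.
have cleared : 'X^a * p = (-1) ^+ e * 'X^b * g.
  apply: ev_inj; rewrite !rmorphM !rmorphXn rmorphN1 /= evX pg.
  rewrite expfzDr // -exprnN -exprnP.
  by move: (ev q g) (q ^+ a) (q ^+ b) (qa0 a) => y u v u0; field.
have := congr1 (ev q^-1) cleared.
rewrite !rmorphM !rmorphXn rmorphN1 /= evX !exprVn opprB expfzDr //.
rewrite -exprnN -exprnP.
move: (ev q^-1 g) (ev q^-1 p) (q ^+ a) (q ^+ b) (qa0 a) => y z u v u0.
move/(canRL (mulKf _)) -> => //; first by rewrite invrK; ring.
by rewrite invr_eq0.
Qed.

Lemma self_reciprocal_sim (e : bool) (m : int) p g :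
  ev q p = (-1) ^+ e * q ^ m * ev q g ->
  self_reciprocal q p <-> self_reciprocal q g.
Proof.
move=> pg; have pg' := ev_inv pg.
have e0 : (-1) ^+ e != 0 :> K by rewrite signr_eq0.
have qm0 (k : int) : q ^ k != 0 by rewrite expfz_neq0.
rewrite /self_reciprocal pg pg' -invr_expz.
split=> -[k sk].
- exists (k - m - m); move: sk; rewrite !expfzDr // -invr_expz.
  move: (ev q g) (ev q^-1 g) (q ^ m) (q ^ k) ((-1) ^+ e : K) (qm0 m) e0.
  move=> y z u v c u0 c0 sk; apply: (mulfI c0); apply: (mulfI u0).
  rewrite mulrA (mulrC u) sk; field; exact: u0.
- exists (k + m + m); rewrite sk !expfzDr //.
  move: (ev q^-1 g) (q ^ m) (q ^ k) ((-1) ^+ e : K) (qm0 m) e0.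
  by move=> z u v c u0 c0; field.
Qed.

Lemma self_reciprocal_rev p :
  self_reciprocal q (reciprocal p) <-> self_reciprocal q p.
Proof.
have qk0 (k : nat) : q ^+ k != 0 by rewrite expf_neq0.
rewrite /self_reciprocal !ev_reciprocal ?invr_eq0 // invrK exprVn.
set d := (size p).-1.
split=> -[k sk]; exists (d%:Z + d%:Z - k).
all: have qk : q ^ k != 0 by rewrite expfz_neq0.
- rewrite !expfzDr // -invr_expz -exprnP; move: sk.
  move: (ev q p) (ev q^-1 p) (q ^+ d) (q ^ k) (qk0 d) qk => y z u v u0 v0 sk.
  have -> : u * u * v^-1 * z = u * v^-1 * (u * z) by ring.
  by rewrite sk; field; rewrite u0 v0.
- rewrite !expfzDr // -invr_expz -exprnP sk.
  move: (ev q^-1 p) (q ^+ d) (q ^ k) (qk0 d) qk => z u v u0 v0.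
  by field; rewrite u0 v0.
Qed.

Lemma self_reciprocal_simV (e : bool) (m : int) p g :
  ev q p = (-1) ^+ e * q ^ m * ev q^-1 g ->
  self_reciprocal q p <-> self_reciprocal q g.
Proof.
move=> pg; rewrite -(self_reciprocal_rev g).
apply: (@self_reciprocal_sim e (m - (size g).-1%:Z)).
rewrite pg ev_reciprocal // expfzDr // -exprnN.
have : q ^+ (size g).-1 != 0 by rewrite expf_neq0.
by move: (q ^+ _) (ev _ g) => u y u0; field.
Qed.

Lemma self_reciprocalP p :
  self_reciprocal q p <->
  exists a b : nat, 'X^a * p = 'X^b * reciprocal p.
Proof.
pose d := (size p).-1.
have qk0 (k : nat) : q ^+ k != 0 by rewrite expf_neq0.
have rp : ev q^-1 p = q ^- d * ev q (reciprocal p).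
  by rewrite ev_reciprocal // mulKf.
split=> [[k sk]|[a [b ab]]].
- have [a [b kab]] := int_subn (k - d%:Z).
  exists a, b; apply: ev_inj; rewrite !rmorphM !rmorphXn /= evX sk rp.
  have -> : k = b%:Z - a%:Z + d%:Z by lia.
  rewrite !expfzDr // -exprnN -!exprnP.
  move: (ev q _) (q ^+ a) (q ^+ b) (q ^+ d) (qk0 a) (qk0 d) => y u v w u0 w0.
  by field; rewrite u0 w0.
- exists (b%:Z - a%:Z + d%:Z); rewrite rp !expfzDr // -exprnN -!exprnP.
  have := congr1 (ev q) ab; rewrite !rmorphM !rmorphXn /= evX.
  move: (ev q p) (ev q _) (q ^+ a) (q ^+ b) (q ^+ d) (qk0 a) (qk0 d).
  move=> x y u v w u0 w0 /(canRL (mulKf u0)) ->.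
  by field; rewrite u0 w0.
Qed.

End SelfReciprocal.

Lemma reciprocal0 p : (reciprocal p).[0] = lead_coef p.
Proof.
rewrite /reciprocal horner_sum; have [->|p0] := eqVneq p 0.
  by rewrite size_poly0 big_ord0 lead_coef0.
rewrite -(prednK (_ : 0 < size p)%N) ?size_poly_gt0 // big_ord_recr /=.
rewrite subnn hornerZ hornerXn mulr1 big1 ?add0r // => i _.
by rewrite hornerZ hornerXn expr0n subn_eq0 leqNgt ltn_ord mulr0.
Qed.

(** Neither [p] nor its reciprocal vanishes at 0, so the powers of ['X] must
    agree. *)
Lemma palindromicP p : p.[0] = 1 ->
  palindromic p <-> exists a b : nat, 'X^a * p = 'X^b * reciprocal p.
Proof.
move=> p1; split=> [pr|[a [b]]]; first by exists 0%N, 0%N; rewrite -pr.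
have p0 : p != 0.
  by apply/eqP=> p0; move/eqP: p1; rewrite p0 horner0 eq_sym oner_eq0.
have rp0 : (reciprocal p).[0] != 0 by rewrite reciprocal0 lead_coef_eq0.
have Xn0 n : 'X^n != 0 :> {poly int} by rewrite monic_neq0 ?monicXn.
have [ab|ba|->] := ltngtP a b; last by move/(mulfI (Xn0 b)).
- rewrite -(subnK (ltnW ab)) addnC exprD -mulrA => /(mulfI (Xn0 a)) pr.
  by move/eqP: p1; rewrite pr hornerM hornerXn expr0n subn_eq0 leqNgt ab mul0r.
- rewrite -(subnK (ltnW ba)) addnC exprD -mulrA => /(mulfI (Xn0 b)) pr.
  by move/eqP: rp0; rewrite -pr hornerM hornerXn expr0n subn_eq0 leqNgt ba mul0r.
Qed.

(** Differentiate at 1, where the reciprocal of [p] has the value [p(1)] and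
    the derivative [deg p * p(1) - p'(1)]. *)
Lemma self_reciprocal_deriv p a b : 'X^a * p = 'X^b * reciprocal p ->
  (p.[1] %| p^`().[1] *+ 2)%Z.
Proof.
have r1 : (reciprocal p).[1] = p.[1].
  rewrite /reciprocal horner_sum [in RHS]horner_coef; apply: eq_bigr => i _.
  by rewrite hornerZ hornerXn !expr1n.
have r1' : (reciprocal p)^`().[1] = (size p).-1%:R * p.[1] - p^`().[1].
  have -> : p^`().[1] = \sum_(i < size p) p`_i * i%:R.
    rewrite -{1}(coefK p) poly_def linear_sum horner_sum.
    apply: eq_bigr => i _ /=.
    by rewrite linearZ /= derivXn hornerZ hornerMn hornerXn expr1n.
  rewrite /reciprocal linear_sum !horner_sum horner_coef mulr_sumr -sumrB.
  apply: eq_bigr => i _ /=.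
  have le_i : (i <= (size p).-1)%N.
    by rewrite -ltnS prednK ?(leq_trans _ (ltn_ord i)).
  by rewrite linearZ /= derivXn hornerZ hornerMn hornerXn !expr1n natrB //; ring.
move/(congr1 (fun f : {poly int} => f^`().[1])).
rewrite !derivM !derivXn !hornerD !hornerM !hornerMn !hornerXn !expr1n r1 r1' => e.
apply/dvdzP; exists (b%:R + (size p).-1%:R - a%:R); move: e.
by move: (p.[1]) (p^`().[1]) (size p).-1 => u v d e; lia.
Qed.

(** * The criterion for words *)

(** One direction comes from the derivative at 1, the other from the rigidity of
    self-dual words; both pass through the divisibility of the trace. *)
Lemma den_self_reciprocal (K : fieldType) (q : K) j w
    (W := word_mx (1 : int) (nseq j true ++ false :: w))
    (a := W 0 0) (c := W 1 0) :
  q != 0 -> injective (ev q) -> last false w = false ->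
  self_reciprocal q (den 'X (nseq j true ++ false :: w)) <->
  (c %| a ^+ 2 + 1)%Z.
Proof.
move=> q0 ev_inj w_last; have det_W := word_mx1_det (nseq j true ++ false :: w).
rewrite (dvdz_trace det_W); split.
  move/(self_reciprocalP q0 ev_inj)=> [m [n mn]].
  have := self_reciprocal_deriv mn.
  rewrite deriv_den horner_den /den subrr mulr0 addr0 -/W -/a -/c => c_dvd.
  rewrite -(subKr ((size (nseq j true ++ false :: w)).+1%:R * c) (a + _)).
  by apply: rpredB; rewrite ?dvdz_mull.
rewrite den_true /a /c /W !word_mx1_nseq {a c W det_W}.
case/lastP: w w_last => [_ _|w b].
  exists 0; rewrite !ev_den /den !word_mx_consE !word_mx_nil !one2E.
  by rewrite expr0z; ring.
rewrite last_rcons => ->; rewrite addrAC rpredDr ?dvdz_mull // => W_dvd.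
have {W_dvd} w_dual : dual w = w by apply: dvdz_self_dual.
exists (size w).+2%:Z; rewrite !ev_den -exprnP.
by apply: den_self_dual => //; rewrite mulfV.
Qed.

(** * Words of continued fractions *)

(** The absolute values make the words of the expansions of [r/s] and [-r/s]
    the same. *)
Fixpoint cf_word (a : seq int) : seq bool :=
  if a is x :: y :: a' then
    nseq `|x|%N true ++ nseq `|y|%N false ++ cf_word a'
  else [::].

Lemma seq2_ind (T : Type) (P : seq T -> Prop) :
  P [::] -> (forall x, P [:: x]) -> (forall x y a, P a -> P [:: x, y & a]) ->
  forall a, P a.
Proof.
move=> P0 P1 P2 a; suff [] : P a /\ forall x, P (x :: a) by [].
by elim: a => [|y a [IH1 IH2]]; split=> // x; apply: P2.
Qed.

Lemma cf_wordN a : cf_word (map -%R a) = cf_word a.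
Proof. by elim/seq2_ind: a => //= x y a ->; rewrite !abszN. Qed.

Lemma last_cf_word a :
  all (fun c => 1 <= c) a -> ~~ odd (size a) -> last false (cf_word a) = false.
Proof.
elim/seq2_ind: a => //= x y a IHa /and3P[x1 y1 a1]; rewrite negbK => odd_a.
rewrite !last_cat.
case E: (cf_word a) (IHa a1 odd_a) => [|b w] //= _.
case: y y1 => [[|n]|n] // _.
by rewrite /=; elim: (n).
Qed.

Lemma cf_word_split x y a :
  1 <= y -> all (fun c => 1 <= c) a -> ~~ odd (size a) ->
  exists w, last false w = false /\
    cf_word [:: x, y & a] = nseq `|x|%N true ++ false :: w.
Proof.
move=> y1 a1 odd_a; exists (nseq `|y|.-1%N false ++ cf_word a); split.
  rewrite last_cat (_ : last _ (nseq _ _) = false) ?last_cf_word //.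
  by elim: (`|y|.-1)%N.
by case: y y1 => [[|n]|n].
Qed.

Lemma cf_value_step x y a (W := word_mx (1 : int) (cf_word a))
    (W' := word_mx (1 : int) (cf_word [:: x, y & a])) :
  0 <= x -> 1 <= y -> 0 < W 0 0 -> 0 <= W 1 0 ->
  cf_value a = (W 0 0)%:~R / (W 1 0)%:~R ->
  [/\ cf_value [:: x, y & a] = (W' 0 0)%:~R / (W' 1 0)%:~R,
      W' 0 0 = x * W' 1 0 + W 0 0 & W' 1 0 = y * W 0 0 + W 1 0].
Proof.
move=> x0 y1 W00 W10 val_a.
have W'10 : W' 1 0 = y * W 0 0 + W 1 0.
  by rewrite /W' /= !word_mx1_nseq gez0_abs //; lia.
have W'00 : W' 0 0 = x * W' 1 0 + W 0 0.
  by rewrite W'10 /W' /= !word_mx1_nseq !gez0_abs 1?addrC //; lia.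
split=> //; rewrite /= -/(cf_value a) val_a W'00 W'10 invf_div.
rewrite !(rmorphD, rmorphM) /=.
have u0 : (W 0 0)%:~R != 0 :> rat by rewrite intr_eq0; lia.
have v0 : (y * W 0 0 + W 1 0)%:~R != 0 :> rat by rewrite intr_eq0; nia.
move: v0; rewrite !(rmorphD, rmorphM) /=.
move: ((W 0 0)%:~R : rat) ((W 1 0)%:~R : rat) (x%:~R : rat) (y%:~R : rat) u0.
by move=> u v k l u0 v0; field; rewrite u0 v0.
Qed.

(** The empty expansion fits in: its value is 0, which is also the quotient
    [1 / 0] of the first column of the identity matrix. *)
Lemma cf_value_tail a (W := word_mx (1 : int) (cf_word a)) :
  all (fun c => 1 <= c) a -> ~~ odd (size a) ->
  [/\ cf_value a = (W 0 0)%:~R / (W 1 0)%:~R, 0 < W 0 0 & 0 <= W 1 0].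
Proof.
rewrite {}/W; elim/seq2_ind: a => // [_ _|x y a IHa /= /and3P[x1 y1 a1]].
  by rewrite /= word_mx_nil !one2E invr0 mulr0.
rewrite negbK => odd_a; have [val_a W00 W10] := IHa a1 odd_a.
have x0 : 0 <= x by lia.
have [val e00 e10] := cf_value_step x0 y1 W00 W10 val_a.
by split; [exact: val | rewrite e00 e10; nia | rewrite e10; nia].
Qed.

Lemma frac_eq_coprime (r s u v : int) : 0 < s -> 0 < v ->
  coprimez r s -> coprimez u v ->
  r%:~R / s%:~R = u%:~R / v%:~R :> rat -> r = u /\ s = v.
Proof.
move=> s0 v0 co_rs co_uv e.
have {}e : r * v = u * s.
  have s0Q : s%:~R != 0 :> rat by rewrite intr_eq0; lia.
  have v0Q : v%:~R != 0 :> rat by rewrite intr_eq0; lia.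
  by move/eqP: e; rewrite eqr_div // -!rmorphM /= => /eqP; apply: intr_inj.
have sv : (s %| v)%Z.
  by rewrite -(Gauss_dvdzr (n := r)) ?e ?dvdz_mull // coprimez_sym.
have vs : (v %| s)%Z.
  by rewrite -(Gauss_dvdzr (n := u)) -?e ?dvdz_mull // coprimez_sym.
have esv : s = v.
  have : `|s|%N == `|v|%N by rewrite eqn_dvd -!dvdzE sv vs.
  by lia.
by split=> //; move: e; rewrite esv => /mulIf ->; lia.
Qed.

Lemma cf_word_matrix (r s : int) x y a :
  0 < s -> coprimez r s -> cf_value [:: x, y & a] = r%:~R / s%:~R ->
  0 <= x -> 1 <= y -> all (fun c => 1 <= c) a -> ~~ odd (size a) ->
  exists j w (W := word_mx (1 : int) (nseq j true ++ false :: w)),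
    [/\ cf_word [:: x, y & a] = nseq j true ++ false :: w,
        last false w = false, W 0 0 = r & W 1 0 = s].
Proof.
move=> s0 co_rs val_a x0 y1 a1 odd_a.
have [val_t t00 t10] := cf_value_tail a1 odd_a.
have [val_W _ W10] := cf_value_step x0 y1 t00 t10 val_t.
have {t10}W10 : 0 < word_mx (1 : int) (cf_word [:: x, y & a]) 1 0.
  by rewrite W10; nia.
have [w [w_last w_eq]] := cf_word_split x y1 a1 odd_a.
rewrite val_a w_eq in val_W; rewrite w_eq in W10.
have [r_eq s_eq] :=
  frac_eq_coprime s0 W10 co_rs (word_mx1_coprime _) val_W.
by exists `|x|%N, w; split.
Qed.

(** * The matrices M_q as words *)

Fact Lq_scale (K : fieldType) (t : K) : t != 0 ->
  mat2 1 0 1 t^-1 = t^-1 *: letter t false.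
Proof.
by move=> t0; apply: mat2_eq; rewrite scale2E !mat2E ?mulr0 ?mulr1 ?mulVf.
Qed.

Lemma Mq_ge0 a : all (fun c => 0 <= c) a ->
  exists k : nat, Mq a = q ^- k *: word_mx q (cf_word a).
Proof.
elim/seq2_ind: a => [_|x _|x y a IHa /= /and3P[x0 y0 /IHa[k ->]]].
- by exists 0%N; rewrite expr0 invr1 scale1r word_mx_nil.
- by exists 0%N; rewrite expr0 invr1 scale1r word_mx_nil.
case: x x0 => // n _; case: y y0 => // m _.
exists (m + k)%N; rewrite !word_mx_cat !word_mx_nseq.
have -> : Lq = q^-1 *: letter q false := Lq_scale q_neq0.
rewrite -[Rq]/(letter q true) -!exprnP exprZn -[_ *m _]/(letter q true ^+ n * _).
rewrite -[_ *m _]/(_ * (_ *: _)).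
by rewrite -!scalerAl -!scalerAr scalerA exprVn -invfM -exprD.
Qed.

Definition flip_mx (K : fieldType) (t : K) : 'M[K]_2 := mat2 1 0 0 (- t).

(** Up to scalars, conjugation by [flip_mx t] inverts both letters at the cost
    of replacing [t] by [t^-1]; this reduces negative expansions to positive
    ones. *)
Fact letter_inv (K : fieldType) (t : K) : t != 0 ->
  mat2 t^-1 (- t^-1) 0 1 * flip_mx t = 1 *: (flip_mx t * letter t^-1 true) /\
  mat2 1 0 (- t) t * flip_mx t = t *: (flip_mx t * letter t^-1 false).
Proof.
by move=> t0; split; apply: mat2_eq; rewrite ?scale2E !mul2E !mat2E; field.
Qed.

Lemma intertwine_mul (K : fieldType) (A B A' B' D : 'M[K]_2) (u v : K) :
  A * D = u *: (D * A') -> B * D = v *: (D * B') ->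
  (A * B) * D = (u * v) *: (D * (A' * B')).
Proof.
move=> AD BD.
rewrite -(mulrA A) BD -scalerAr (mulrA A) AD -scalerAl scalerA -(mulrA D).
by rewrite (mulrC v).
Qed.

Lemma intertwine_expr (K : fieldType) (A B D : 'M[K]_2) (k : K) n :
  A * D = k *: (D * B) -> A ^+ n * D = k ^+ n *: (D * B ^+ n).
Proof.
move=> AD; elim: n => [|n IHn]; first by rewrite !expr0 mul1r mulr1 scale1r.
by rewrite !exprS (intertwine_mul AD IHn).
Qed.

Lemma Mq_le0 a : all (fun c => c <= 0) a ->
  exists k : nat,
    Mq a * flip_mx q = q ^+ k *: (flip_mx q * word_mx q^-1 (cf_word a)).
Proof.
elim/seq2_ind: a => [_|x _|x y a IHa /= /and3P[x0 y0 /IHa[k Mk]]].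
- by exists 0%N; rewrite expr0 scale1r word_mx_nil mul1r mulr1.
- by exists 0%N; rewrite expr0 scale1r word_mx_nil mul1r mulr1.
have [n ->] : exists n : nat, x = - n%:Z by exists `|x|%N; lia.
have [m ->] : exists m : nat, y = - m%:Z by exists `|y|%N; lia.
have [RD LD] := letter_inv q_neq0.
rewrite -!exprz_inv RqV LqV -!exprnP !abszN !absz_nat.
rewrite !word_mx_cat !word_mx_nseq.
exists (m + k)%N; rewrite exprD.
have LM := intertwine_mul (intertwine_expr m LD) Mk.
have := intertwine_mul (intertwine_expr n RD) LM.
rewrite expr1n mul1r; exact.
Qed.

Fact den_flip (K : fieldType) (t k : K) (A : 'M[K]_2) w : t != 0 ->
  A * flip_mx t = k *: (flip_mx t * word_mx t^-1 w) ->
  A 1 0 * 1 + A 1 1 * (1 - t) = (-1) ^+ true * (k * t) * den t^-1 w.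
Proof.
move=> t0 /matrixP e; have := (e 1 0, e 1 1).
rewrite !scale2E !mul2E !mat2E => -[e10 e11].
have e11' : A 1 1 = k * word_mx t^-1 w 1 1.
  have t0' : - t != 0 by rewrite oppr_eq0.
  apply: (mulIf t0'); rewrite -[LHS](add0r (A 1 1 * - t)).
  by rewrite -[X in X + _](mulr0 (A 1 0)) e11; ring.
have e10' : A 1 0 = k * (- t * word_mx t^-1 w 1 0).
  by rewrite -[LHS]addr0 -[X in _ + X](mulr0 (A 1 1)) -[A 1 0]mulr1 e10; ring.
by rewrite /den e11' e10'; field.
Qed.

(** Negative expansions have the word of the opposite fraction, evaluated at
    [q^-1]; hence the square of [r], in which the sign is lost. *)
Lemma left_qrat_den (r s : int) (N : qfield) (S : {poly int}) :
  0 < s -> coprimez r s -> left_qrat_pair r s N S ->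
  exists j w (v := nseq j true ++ false :: w) (W := word_mx (1 : int) v)
      (a := W 0 0) (c := W 1 0) (x : qfield) (e : bool) (m : int),
    [/\ last false w = false, c = s, (s %| a ^+ 2 - r ^+ 2)%Z,
        x = q \/ x = q^-1 & ev q S = (-1) ^+ e * q ^ m * den x v].
Proof.
move=> s0 co_rs [b [[sz_b odd_b val_b [pos_b neg_b zero_b]] _ _ [e [n NS]] _]].
have q0 := q_neq0.
have {}NS : ev q S =
    (-1) ^+ e * q ^ n * (Mq b 1 0 * 1 + Mq b 1 1 * (1 - q)).
  move/colP/(_ 1): NS; rewrite mxE [X in _ = X]mxE mulmx2E !mxE /= => <-.
  by rewrite tofrac_ev.
case: b sz_b odd_b val_b pos_b neg_b zero_b NS => [|x [|y b]] // _ odd_b.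
move=> val_b pos_b neg_b zero_b NS.
have {}odd_b : ~~ odd (size b) by move: odd_b; rewrite /= negbK.
have [r0|r0|r0] := ltrgt0P r.
- have [/= x0 /andP[y1 b1]] := pos_b r0.
  have [j [w [w_eq w_last W00 W10]]] :=
    cf_word_matrix s0 co_rs val_b x0 y1 b1 odd_b.
  have [|k Mk] := @Mq_ge0 [:: x, y & b].
    by rewrite /= x0 (le_trans _ y1) //=; apply: sub_all b1 => c; lia.
  exists j, w, q, e, (n - k%:Z); split=> //; first by rewrite W00 subrr.
    by left.
  rewrite NS Mk w_eq !scale2E /den expfzDr // -exprnN -!mulrA mulr1.
  by rewrite -mulrDr.
- have [/= x0 /andP[y1 b1]] := neg_b r0.
  have [||||||j [w [w_eq w_last W00 W10]]] :=
    @cf_word_matrix (- r) s (- x) (- y) (map -%R b) s0.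
  + by rewrite /coprimez gcdNz.
  + rewrite -[[:: - x, - y & _]]/(map -%R [:: x, y & b]) cf_valueN val_b.
    by rewrite rmorphN mulNr.
  + by lia.
  + by lia.
  + by rewrite all_map; apply: sub_all b1 => c /=; lia.
  + by rewrite size_map.
  have [|k Mk] := @Mq_le0 [:: x, y & b].
    by rewrite /= x0 (le_trans y1) //=; apply: sub_all b1 => c; lia.
  rewrite -[[:: - x, - y & _]]/(map -%R [:: x, y & b]) cf_wordN in w_eq.
  exists j, w, q^-1, (~~ e), (n + k.+1%:Z); split=> //.
  + by rewrite W00 sqrrN subrr.
  + by right.
  rewrite NS (den_flip q0 Mk) w_eq expfzDr // -exprnP exprSr !mulrA.
  by congr (_ * _ * _ * _); rewrite mulrAC -signr_addb addbT.
- (* Only here the exponents have mixed signs: M_q is Rq^-1 Lq, whereas the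
     word used is R L; this is harmless since R does not affect den. *)
  have s1 : s = 1.
    by move: co_rs; rewrite r0 /coprimez gcd0z => /eqP; lia.
  have [ex ey eb] := zero_b r0; rewrite ex ey eb in NS.
  exists 1%N, [::], q, e, (n - 1); split=> //.
  + by rewrite s1 !word_mx1_consE word_mx_nil !one2E.
  + by rewrite s1 dvd1z.
  + by left.
  have -> : den q (nseq 1 true ++ [:: false]) = 1.
    rewrite den_true /den !word_mx_consE word_mx_nil !one2E.
    by rewrite !(mulr0, mulr1, addr0, add0r, mul1r) addrC subrK.
  rewrite NS /= mulmx1 exprN1 RqV expr1z !mulmx2E !mxE /=.
  rewrite expfzDr // mulr1 -mulrA [RHS]mulr1 exprN1; congr (_ * (_ * _)).
  rewrite !(mul0r, mul1r, mulr1, add0r, mulr0) mulrBr mulVf // mulr1.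
  by rewrite addrC subrK.
Qed.

Unset Implicit Arguments.

Theorem theorem1p2 (r s : int) (s_gt0 : 0 < s) (co_rs : coprimez r s)
    (N : qfield) (S : {poly int}) (NS : left_qrat_pair r s N S) :
  palindromic S <-> (r ^+ 2 = -1 %[mod s])%Z.
Proof.
have S1 : S.[0] = 1 by case: NS => b [].
have [j [w [x [e [m [w_last c_eq a_sq x_eq S_eq]]]]]] :=
  left_qrat_den s_gt0 co_rs NS.
have -> : palindromic S <-> self_reciprocal q S.
  by rewrite palindromicP // (self_reciprocalP q_neq0 ev_q_inj).
have -> : self_reciprocal q S <->
    self_reciprocal q (den 'X (nseq j true ++ false :: w)).
  rewrite -ev_den in S_eq.
  case: x_eq => x_eq; rewrite x_eq in S_eq.
    exact: (self_reciprocal_sim q_neq0 ev_q_inj S_eq).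
  exact: (self_reciprocal_simV q_neq0 ev_q_inj S_eq).
rewrite (den_self_reciprocal j q_neq0 ev_q_inj w_last) c_eq.
have -> : (r ^+ 2 = -1 %[mod s])%Z <-> (s %| r ^+ 2 + 1)%Z.
  by rewrite -[X in _ + X]opprK -eqz_mod_dvd; split=> /eqP.
set a := word_mx _ _ 0 0 in a_sq *.
have -> : a ^+ 2 + 1 = (a ^+ 2 - r ^+ 2) + (r ^+ 2 + 1) by ring.
by rewrite rpredDl.
Qed.
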